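(* Let $q\in[1,\infty)$, $\alpha\in[0,\infty)$, $s\in\mathbb{Z}_+$ and let $Q_0\subsetneqq\mathbb{R}^n$ be a closed cube. Then $$\mathcal{C}_{\alpha,q,s}(Q_0)=\left\{f\in\bigcap_{p\in(1,\infty)}JN_{(p,q,s)_\alpha}(Q_0):\ \lim_{p\to\infty}\|f\|_{JN_{(p,q,s)_\alpha}(Q_0)}<\infty\right\}$$ and, for any $f\in\mathcal{C}_{\alpha,q,s}(Q_0)$, $$\|f\|_{\mathcal{C}_{\alpha,q,s}(Q_0)}=\lim_{p\to\infty}\|f\|_{JN_{(p,q,s)_\alpha}(Q_0)}.$$
   Context: $\mathbb{Z}_+$ is the set of non-negative integers. Cubes in $\mathbb{R}^n$ have edges parallel to the coordinate axes and finite positive edge length. For $s\in\mathbb{Z}_+$, a cube $Q$ and an integrable $f$, $P_Q^{(s)}(f)$ denotes the unique polynomial of degree not greater than $s$ such that $\int_Q[f(x)-P_Q^{(s)}(f)(x)]x^\gamma\,dx=0$ for all multi-indices $\gamma\in\mathbb{Z}_+^n$ with $|\gamma|\le s$. $L^1_{\mathrm{loc}}(Q_0)$ is the set of measurable $f$ with $f\mathbf 1_E\in L^1(Q_0)$ for every bounded $E\subset Q_0$ (so it equals $L^1(Q_0)$). Campanato space: $\mathcal{C}_{\alpha,q,s}(Q_0)$ is the set of $f\in L^1_{\mathrm{loc}}(Q_0)$ with $$\|f\|_{\mathcal{C}_{\alpha,q,s}(Q_0)}:=\sup_Q|Q|^{-\alpha}\left[\frac1{|Q|}\int_Q|f-P_Q^{(s)}(f)|^q\right]^{1/q}<\infty,$$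 the supremum being over all closed cubes $Q$ in $Q_0$. John--Nirenberg--Campanato space: for $p\in(1,\infty)$, $JN_{(p,q,s)_\alpha}(Q_0)$ is the set of $f\in L^1_{\mathrm{loc}}(Q_0)$ with $$\|f\|_{JN_{(p,q,s)_\alpha}(Q_0)}:=\sup\left\{\sum_i|Q_i|\left[|Q_i|^{-\alpha}\left(\frac1{|Q_i|}\int_{Q_i}|f-P_{Q_i}^{(s)}(f)|^q\right)^{1/q}\right]^p\right\}^{1/p}<\infty,$$ the supremum being over all collections of pairwise disjoint cubes $\{Q_i\}_i$ in $Q_0$. *)

(* Defs.v *)
From HB Require Import structures.
From mathcomp Require Import all_boot all_order all_algebra.
(* mpoly's notations and its isMeasure clash with those of analysis, hence the
   filter and the import order. *)
From mathcomp Require Import -(notations) mpoly.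
From mathcomp Require Import all_classical all_reals all_analysis.
Import Order.TTheory GRing.Theory Num.Theory.
Import numFieldNormedType.Exports.

Set Implicit Arguments.
Unset Strict Implicit.
Unset Printing Implicit Defensive.

Local Open Scope classical_set_scope.
Local Open Scope ring_scope.

(* The product sigma-algebra on n.+1-tuples is identified with that of
   R * R^n, which carries the library's binary product measure. *)
Section cons_measure.
Local Open Scope ereal_scope.
Context (R : realType) (n : nat).
Local Notation T := (measurableTypeR R).
Variable m : {sigma_finite_measure set (n.-tuple T) -> \bar R}.

Definition cons_pair (x : T * n.-tuple T) : n.+1.-tuple T :=
  [the n.+1.-tuple T of x.1 :: x.2].

Definition uncons (t : n.+1.-tuple T) : T * n.-tuple T :=
  (tnth t ord0, [tuple of behead t]).

Lemma cons_pairK : cancel cons_pair uncons.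
Proof.
by move=> [x t]; congr pair; exact/val_inj.
Qed.

Lemma unconsK : cancel uncons cons_pair.
Proof.
by move=> t; rewrite [RHS]tuple_eta; apply/val_inj.
Qed.

Lemma measurable_cons_pair : measurable_fun [set: T * n.-tuple T] cons_pair.
Proof. exact: measurable_cons. Qed.

Lemma measurable_uncons : measurable_fun [set: n.+1.-tuple T] uncons.
Proof.
apply/measurable_fun_pairP; split => /=.
  exact: measurable_tnth.
exact: measurable_behead.
Qed.

Definition cons_measure : set (n.+1.-tuple T) -> \bar R :=
  pushforward (@lebesgue_measure R \x m) cons_pair.

Let cons_measure0 : cons_measure set0 = 0.
Proof. by rewrite /cons_measure /pushforward preimage_set0 measure0. Qed.

Let cons_measure_ge0 A : 0 <= cons_measure A.
Proof. by rewrite /cons_measure /pushforward measure_ge0. Qed.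

Let cons_measure_sigma_additive : semi_sigma_additive cons_measure.
Proof.
have mf := measurable_cons_pair.
move=> F mF tF mUF; rewrite /cons_measure /pushforward preimage_bigcup.
apply: measure_semi_sigma_additive.
- by move=> k; rewrite -[X in measurable X]setTI; exact: mf.
- apply/trivIsetP => /= i j _ _ ij; rewrite -preimage_setI.
  by move/trivIsetP : tF => /(_ _ _ _ _ ij) ->//; rewrite preimage_set0.
- by rewrite -preimage_bigcup -[X in measurable X]setTI; exact: mf.
Qed.

HB.instance Definition _ := isMeasure.Build _ _ _ cons_measure
  cons_measure0 cons_measure_ge0 cons_measure_sigma_additive.

Let cons_measure_sigma_finite : sigma_finite setT cons_measure.
Proof.
have /sigma_finiteP[F [TF ndF Foo]] := sigma_finiteT (@lebesgue_measure R).
have /sigma_finiteP[G [TG ndG Goo]] := sigma_finiteT m.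
exists (fun k => uncons @^-1` (F k `*` G k)).
  apply/seteqP; split=> // t _.
  have [i _ Fi] : (\bigcup_i F i) (uncons t).1 by rewrite -TF.
  have [j _ Gj] : (\bigcup_i G i) (uncons t).2 by rewrite -TG.
  exists (maxn i j) => //; split.
    by move: Fi; exact/subsetPset/ndF/leq_maxl.
  by move: Gj; exact/subsetPset/ndG/leq_maxr.
move=> k; have [? ?] := Foo k; have [? ?] := Goo k; split.
  rewrite -[X in measurable X]setTI; apply: measurable_uncons => //.
  exact: measurableX.
rewrite /cons_measure /pushforward -comp_preimage.
rewrite (_ : uncons \o cons_pair = id) ?preimage_id; last first.
  by apply/funext => x /=; rewrite cons_pairK.
by rewrite product_measure1E// lte_mul_pinfty// ge0_fin_numE.
Qed.

HB.instance Definition _ :=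
  Measure_isSigmaFinite.Build _ _ _ cons_measure cons_measure_sigma_finite.

End cons_measure.

Fixpoint borel_lebesgue (R : realType) (n : nat) :
    {sigma_finite_measure set (n.-tuple (measurableTypeR R)) -> \bar R} :=
  match n with
  | 0 => dirac [tuple]
  | k.+1 => cons_measure (borel_lebesgue R k)
  end.

Lemma borel_lebesgue_box (R : realType) (n : nat)
    (A : 'I_n -> set (measurableTypeR R)) :
  (forall i, measurable (A i)) ->
  borel_lebesgue R n [set x | forall i, A i (tnth x i)] =
  (\prod_(i < n) lebesgue_measure (A i))%E.
Proof.
elim: n A => [|n ih] A mA.
  by rewrite big_ord0 /= diracE mem_set// => -[].
rewrite big_ord_recl -ih//= /cons_measure /pushforward.
rewrite -product_measure1E//.
  congr product_measure1; apply/seteqP; split=> -[x t] /=.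
    by move=> h; split=> [|i]; [have := h ord0|have := h (lift ord0 i)];
      rewrite ?tnth0 ?tnthS.
  move=> [h0 h] i; case: (unliftP ord0 i) => [j|] ->.
    by rewrite tnthS; exact: h.
  by rewrite tnth0.
rewrite (_ : mkset _ = \bigcap_(i in [set: 'I_n])
   ((@tnth n _)^~ i @^-1` (A (lift ord0 i)))); last first.
  by apply/seteqP; split=> [t h i _|t h i] /=; [exact: h|exact: (h i I)].
apply: fin_bigcap_measurable => [|i _]; first exact: finite_finset.
by rewrite -[X in measurable X]setTI; exact: measurable_tnth.
Qed.

(* R^n with the Lebesgue sigma-algebra: the Caratheodory completion of the
   product Borel sigma-algebra. *)
Definition Rn (R : realType) (n : nat) : Type :=
  caratheodory_type ((borel_lebesgue R n)^*)%mu.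

HB.instance Definition _ (R : realType) (n : nat) :=
  Measurable.copy (Rn R n) (caratheodory_type ((borel_lebesgue R n)^*)%mu).

Definition lebesgue (R : realType) (n : nat) : set (Rn R n) -> \bar R :=
  @completed_measure_extension _ _ R (borel_lebesgue R n).

HB.instance Definition _ (R : realType) (n : nat) :=
  Measure.on (@lebesgue R n).

Lemma lebesgue_box (R : realType) (n : nat)
    (A : 'I_n -> set (measurableTypeR R)) :
  (forall i, measurable (A i)) ->
  measurable ([set x | forall i, A i (tnth x i)] : set (Rn R n)) /\
  lebesgue ([set x | forall i, A i (tnth x i)] : set (Rn R n)) =
  (\prod_(i < n) lebesgue_measure (A i))%E.
Proof.
move=> mA.
have mB : measurable ([set x | forall i, A i (tnth x i)] :
    set (n.-tuple (measurableTypeR R))).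
  rewrite (_ : mkset _ = \bigcap_(i in [set: 'I_n])
      ((@tnth n _)^~ i @^-1` (A i))).
    apply: fin_bigcap_measurable => [|i _]; first exact: finite_finset.
    by rewrite -[X in measurable X]setTI; exact: measurable_tnth.
  by apply/seteqP; split=> [t h i _|t h i] /=; [exact: h|exact: (h i I)].
split; first exact: caratheodory_measurable_mu_ext.
rewrite -borel_lebesgue_box// /lebesgue /completed_measure_extension.
exact: measurable_mu_extE.
Qed.

Section cubes.
Context (R : realType) (n : nat).
Implicit Types Q E : set (Rn R n).

Definition coord (x : Rn R n) (i : 'I_n) : R := tnth x i.

(* A cube is a product of n intervals of the same length l > 0 with corner a;
   each endpoint may or may not belong to the cube (BSide true c as a left
   bound includes c, as a right bound excludes it). *)
Definition cube Q : Prop :=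
  exists (a : 'I_n -> R) (l : R) (b b' : 'I_n -> bool), 0 < l /\
  Q = [set x | forall i, coord x i \in
        Interval (BSide (b i) (a i)) (BSide (b' i) (a i + l))].

Definition closed_cube Q : Prop :=
  exists (a : 'I_n -> R) (l : R), 0 < l /\
  Q = [set x | forall i, coord x i \in `[a i, a i + l]].

Definition bounded_in_Rn E : Prop :=
  exists M : R, forall x, E x -> forall i, `|coord x i| <= M.

End cubes.

Section spaces.
Context (R : realType) (n : nat).
Implicit Types (Q E : set (Rn R n)) (f : Rn R n -> R).
Local Notation mu := (@lebesgue R n).

(* Functions on Q0 are represented by functions on the whole of R^n whose
   values outside Q0 are irrelevant. *)
Definition L1loc (Q0 : set (Rn R n)) : set (Rn R n -> R) :=
  [set f : Rn R n -> R | measurable_fun Q0 f /\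
    forall E, measurable E -> bounded_in_Rn E -> E `<=` Q0 ->
      mu.-integrable Q0 (EFin \o (f \* \1_E))].

Definition is_projection (s : nat) Q f (P : mpoly n R) : Prop :=
  (forall g, g \in msupp P -> (mdeg g <= s)%N) /\
  forall g : multinom n, (mdeg g <= s)%N ->
    (\int[mu]_(x in Q)
       ((f x - meval (coord x) P) * \prod_(i < n) coord x i ^+ g i)%:E
     = 0)%E.

(* P_Q^(s)(f), as the polynomial satisfying is_projection (0 if there is none,
   which does not happen for f integrable on a cube Q) *)
Definition projection (s : nat) Q f : mpoly n R :=
  xget 0 [set P | is_projection s Q f P].

Local Open Scope ereal_scope.

(* |Q|^(-alpha) [ |Q|^-1 \int_Q |f - P_Q^(s)(f)|^q ]^(1/q) *)
Definition mean_osc (alpha q : R) (s : nat) Q f : \bar R :=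
  mu Q `^ (- alpha) *
  ((mu Q)^-1 *
   \int[mu]_(x in Q)
     (`|f x - meval (coord x) (projection s Q f)| `^ q)%:E) `^ q^-1.

Definition campanato_norm (alpha q : R) (s : nat)
    (Q0 : set (Rn R n)) f : \bar R :=
  ereal_sup [set mean_osc alpha q s Q f | Q in
    [set Q | closed_cube Q /\ Q `<=` Q0]].

Definition campanato (alpha q : R) (s : nat) (Q0 : set (Rn R n)) :
    set (Rn R n -> R) :=
  [set f : Rn R n -> R | L1loc Q0 f /\ campanato_norm alpha q s Q0 f < +oo].

(* Such a family is automatically countable, every cube having an interior
   point; it may be finite or empty. *)
Definition disjoint_cubes (Q0 : set (Rn R n)) : set (set (set (Rn R n))) :=
  [set C | (forall Q, C Q -> cube Q /\ Q `<=` Q0) /\ trivIset C id].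

Definition jnc_norm (p q : R) (s : nat) (alpha : R)
    (Q0 : set (Rn R n)) f : \bar R :=
  ereal_sup [set (\esum_(Q in C) mu Q * (mean_osc alpha q s Q f) `^ p) `^ p^-1
            | C in disjoint_cubes Q0].

Definition jnc (p q : R) (s : nat) (alpha : R) (Q0 : set (Rn R n)) :
    set (Rn R n -> R) :=
  [set f : Rn R n -> R | L1loc Q0 f /\ jnc_norm p q s alpha Q0 f < +oo].

End spaces.

(* Main.v *)
(* Let a(Q) be the normalized mean oscillation of f on Q. The one-element family
   {Q} gives |Q|^(1/p) a(Q) <= ||f||_JN, and disjointness of the Q_i gives
   sum |Q_i| a(Q_i)^p <= |Q_0| (sup a)^p, hence ||f||_JN <= |Q_0|^(1/p) sup a.
   As m^(1/p) -> 1 for each m > 0, the JN norms tend to the Campanato norm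
   sup a in [0, +oo], for every f measurable on Q_0; both claims follow. The
   cubes of a JN family need not be closed, but a closed Q_0 contains the
   closure of each of them, which changes neither |Q| nor any integral, hence
   neither P_Q nor a(Q). *)
Require Import Defs.
From mathcomp Require Import all_boot all_order all_algebra.
From mathcomp Require Import -(notations) mpoly.
From mathcomp Require Import all_classical all_reals all_analysis.
From mathcomp Require Import measurable_realfun lra.
Import Order.TTheory GRing.Theory Num.Theory.
Import numFieldNormedType.Exports.

Set Implicit Arguments.
Unset Strict Implicit.
Unset Printing Implicit Defensive.

Local Open Scope classical_set_scope.
Local Open Scope ring_scope.

(** * Limits in the extended reals: [p]-th roots and weighted suprema *)

Section limits.
Context (R : realType).
Implicit Types m p : R.
Local Open Scope ereal_scope.

Lemma cvg_powRV m : (0 < m)%R -> (m `^ p^-1)%R @[p --> +oo%R] --> (1 : R)%R.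
Proof.
move=> m0.
have -> : (fun p => m `^ p^-1)%R = (fun p => expR (p^-1 * ln m))%R.
  by apply/funext => p; rewrite /powR gt_eqF.
have V0 : p^-1%R @[p --> +oo%R] --> (0 : R)%R.
  by apply/gtr0_cvgV0 => //; apply: nbhs_pinfty_gt; rewrite num_real.
rewrite -[X in _ --> X](@expR0 R) -[in X in _ --> X](mul0r (ln m)).
apply: continuous_cvg; first exact: continuous_expR.
exact: cvgMr_tmp.
Qed.

Lemma poweR_mul_powRV (x a : \bar R) (p : R) : (0 < p)%R -> 0 <= x -> 0 <= a ->
  (x * a `^ p) `^ p^-1 = x `^ p^-1 * a.
Proof.
move=> p0 x0 a0.
by rewrite poweRM ?poweR_ge0// -poweRrM mulfV ?gt_eqF// poweRe1.
Qed.

(** The order form of convergence treats finite and infinite limits alike. For a real [l], the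
    bounds [l - 1] and [l + 1] make [f] eventually finite, and [l - e] and [l + e] then give the
    metric estimate. *)
Lemma cvge_between (T : Type) (F : set_system T) (FF : ProperFilter F)
    (f : T -> \bar R) (l : \bar R) : -oo < l ->
  (forall y : R, y%:E < l -> \forall x \near F, y%:E < f x) ->
  (forall y : R, l < y%:E -> \forall x \near F, f x < y%:E) ->
  f @ F --> l.
Proof.
case: l => [l _ lo up||//]; last first.
  by move=> _ lo _; apply/cvgeyPgt => A; apply: lo; exact: ltry.
apply/fine_cvgP; split.
  have := lo (l - 1)%R; have := up (l + 1)%R.
  rewrite !lte_fin ltrDl gtrBl ltr01 => /(_ isT) up1 /(_ isT) lo1.
  near=> x; rewrite fin_numElt; apply/andP; split.
    by apply: (@lt_trans _ _ (l - 1)%:E); [exact: ltNyr|near: x].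
  by apply: (@lt_trans _ _ (l + 1)%:E); [near: x|exact: ltry].
apply/cvgrPdist_lt => e e0.
have := lo (l - e)%R; have := up (l + e)%R.
rewrite !lte_fin ltrDl gtrBl e0 => /(_ isT) up1 /(_ isT) lo1.
near=> x.
have : (l - e)%:E < f x by near: x.
have : f x < (l + e)%:E by near: x.
rewrite /=; case: (f x) => [r||] //=; rewrite !lte_fin => h1 h2.
by rewrite ltr_norml; apply/andP; split; lra.
Unshelve. all: by end_near. Qed.

Lemma cvg_powRV_ereal_sup (I : Type) (D : set I) (m : I -> R) (a : I -> \bar R)
    (m0 : R) (f : R -> \bar R) :
  let S := ereal_sup [set a i | i in D] in
  (0 < m0)%R -> (forall i, D i -> (0 < m i)%R) -> 0 <= S ->
  (forall i p, D i -> (1 < p)%R -> (m i `^ p^-1)%:E * a i <= f p) ->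
  (forall p, (1 < p)%R -> f p <= (m0 `^ p^-1)%:E * S) ->
  f p @[p --> +oo%R] --> S.
Proof.
move=> S m0_gt0 m_gt0 S_ge0 lo up.
have p1 : \forall p \near +oo%R, (1 < p :> R)%R.
  by apply: nbhs_pinfty_gt; rewrite num_real.
apply: cvge_between => [|y yS|y Sy]; first exact: lt_le_trans S_ge0.
  have [_ [i Di <-] yai] := ereal_sup_gt yS.
  have := lo i; have := cvg_powRV (m_gt0 _ Di).
  (* Exceeding a real, [a i] is real or [+oo]; if it is [+oo], its positive weight already forces
     [f p] to be [+oo]. *)
  case: (a i) yai => [r||//] yr mi1 loi; last first.
    near=> p; apply: lt_le_trans (loi p Di _); last by near: p.
    by rewrite gt0_muley ?ltry// lte_fin powR_gt0// m_gt0.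
  have /cvgr_gt : (m i `^ p^-1 * r)%R @[p --> +oo%R] --> (1 * r)%R.
    exact: cvgMr_tmp.
  move: yr; rewrite lte_fin mul1r => yr /(_ y yr) h; near=> p.
  apply: lt_le_trans (loi p Di _); last by near: p.
  by rewrite -EFinM lte_fin; near: p.
(* No real exceeds [+oo], so only a real [S] remains. *)
case: S S_ge0 Sy up => [r|//|//] r0 ry up.
have /cvgr_lt : (m0 `^ p^-1 * r)%R @[p --> +oo%R] --> (1 * r)%R.
  by apply: cvgMr_tmp; exact: cvg_powRV.
move: ry; rewrite lte_fin mul1r => ry /(_ y ry) h; near=> p.
apply: (le_lt_trans (up p _)); first by near: p.
by rewrite -EFinM lte_fin; near: p.
Unshelve. all: by end_near. Qed.

End limits.

(** * Cubes: measure, closure, and measurability of polynomials *)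

Section cubes.
Context (R : realType) (n : nat).
Local Notation mu := (@lebesgue R n).
Local Notation coord := (@Defs.coord R n).
Implicit Types (Q : set (Rn R n)) (f : Rn R n -> R).

(** The side flags are parameters, so that the closure of a cube keeps [a] and [l] and sets the
    flags to [true] and [false]. *)
Definition cube_of (a : 'I_n -> R) (l : R) (b b' : 'I_n -> bool) :
    set (Rn R n) :=
  [set x | forall i, coord x i \in
     Interval (BSide (b i) (a i)) (BSide (b' i) (a i + l))].

Lemma measurable_cube_of a l b b' : measurable (cube_of a l b b').
Proof.
exact: (lebesgue_box (A := fun i : 'I_n =>
  [set` Interval (BSide (b i) (a i)) (BSide (b' i) (a i + l))]) _).1.
Qed.

Lemma lebesgue_cube_of a l b b' : 0 < l ->
  mu (cube_of a l b b') = (l ^+ n)%:E.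
Proof.
move=> l0.
rewrite (lebesgue_box (A := fun i : 'I_n =>
  [set` Interval (BSide (b i) (a i)) (BSide (b' i) (a i + l))]) _).2//.
under eq_bigr => i _.
  rewrite lebesgue_measure_itv/= lte_fin ltrDl l0 -EFinD addrAC subrr add0r.
  over.
by rewrite prodEFin prodr_const card_ord.
Qed.

Lemma sub_closure_cube_of a l b b' :
  cube_of a l b b' `<=` cube_of a l (fun=> true) (fun=> false).
Proof.
move=> x xQ i; have := xQ i; rewrite !in_itv/=.
by case/andP=> /lteifW -> /lteifW ->.
Qed.

(* Moving from a corner into a cube along the diagonal stays in the cube, even
   when the corner itself is excluded. *)
Lemma closure_cube_of_sub a l b b' c L : 0 < l ->
  cube_of a l b b' `<=` cube_of c L (fun=> true) (fun=> false) ->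
  cube_of a l (fun=> true) (fun=> false)
    `<=` cube_of c L (fun=> true) (fun=> false).
Proof.
move=> l0 sub.
have diag e i : 0 < e < l -> c i <= a i + e <= c i + L.
  move=> /andP[e0 el].
  have /sub /(_ i) : cube_of a l b b' [tuple a j + e | j < n].
    move=> j; rewrite /Defs.coord tnth_mktuple in_itv/=.
    by rewrite !lteifS ?ltrDl ?ltrD2l.
  by rewrite /Defs.coord tnth_mktuple in_itv/=.
move=> x xQ i; have := xQ i; rewrite !in_itv/= => /andP[ax xa].
apply/andP; split.
  apply: le_trans ax; rewrite leNgt; apply/negP => ac.
  (* Half the gap keeps [a i + e] below [c i]; the term [l / 2] keeps [e] inside the range of
     [diag]. *)
  pose e := Num.min (l / 2) ((c i - a i) / 2).
  have /(diag _ i) /andP[+ _] : 0 < e < l.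
    by rewrite /e lt_min gt_min !divr_gt0 ?subr_gt0//=
      gtr_pMr// invf_lt1 ?ltr1n.
  have : e <= (c i - a i) / 2 by rewrite ge_min lexx orbT.
  by move: ac; lra.
apply: (le_trans xa); rewrite leNgt; apply/negP => ac.
(* The same choice at the opposite corner: the diagonal is taken at [l - e], where its [i]-th
   coordinate still exceeds [c i + L]. *)
pose e := Num.min (l / 2) ((a i + l - (c i + L)) / 2).
have e0l : 0 < e < l.
  by rewrite /e lt_min gt_min !divr_gt0 ?subr_gt0//=
    gtr_pMr// invf_lt1 ?ltr1n.
have /(diag _ i) /andP[_] : 0 < l - e < l by move: e0l; lra.
have : e <= (a i + l - (c i + L)) / 2 by rewrite ge_min lexx orbT.
by move: ac; lra.
Qed.

(** Both cubes have the finite measure [l ^+ n], so their difference is null with no need to examine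
    the faces. *)
Lemma cube_closureP Q : cube Q -> exists2 Q' : set (Rn R n),
  closed_cube Q' /\ Q `<=` Q' &
  [/\ measurable Q, measurable Q', mu Q' = mu Q, mu (Q' `\` Q) = 0%E &
   forall Q0, closed_cube Q0 -> Q `<=` Q0 -> Q' `<=` Q0].
Proof.
move=> [a [l [b [b' [l0 ->]]]]].
have mQ := @measurable_cube_of a l b b'.
have mQ' := @measurable_cube_of a l (fun=> true) (fun=> false).
rewrite -/(cube_of a l b b').
exists (cube_of a l (fun=> true) (fun=> false)).
  by split; [exists a, l|exact: sub_closure_cube_of].
split => //; first by rewrite !lebesgue_cube_of.
  rewrite measureD ?setIidr; [|exact: sub_closure_cube_of|by []..|].
    by rewrite [X in (X - _)%E]lebesgue_cube_of//
      [X in (_ - X)%E]lebesgue_cube_of// subee.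
  by rewrite [ltLHS]lebesgue_cube_of ?ltry.
by move=> _ [c [L [L0 ->]]]; exact: closure_cube_of_sub.
Qed.

Lemma closed_cube_cube Q : closed_cube Q -> cube Q.
Proof. by move=> [a [l [l0 ->]]]; exists a, l, xpredT, xpred0. Qed.

Lemma closed_cube_measure Q : closed_cube Q -> measurable Q /\
  exists2 r : R, 0 < r & mu Q = r%:E.
Proof.
move=> [a [l [l0 ->]]]; split; first exact: measurable_cube_of.
by exists (l ^+ n); [exact: exprn_gt0|exact: lebesgue_cube_of].
Qed.

Lemma measurable_coord (D : set (Rn R n)) (i : 'I_n) :
  measurable_fun D (fun x => coord x i).
Proof.
move=> mD Y mY; apply: measurableI => //.
(* The preimage of [Y] is a box with side [Y] in direction [i] and the whole line in the others. *)
pose A (j : 'I_n) : set (measurableTypeR R) := if j == i then Y else setT.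
rewrite (_ : _ @^-1` _ = [set x : Rn R n | forall j, A j (tnth x j)]).
  by apply: (lebesgue_box _).1 => j; rewrite /A; case: ifP.
apply/seteqP; split=> x /=; last by move=> /(_ i); rewrite /A eqxx.
by move=> Yx j; rewrite /A; case: eqP => [->|].
Qed.

Lemma measurable_monomial (D : set (Rn R n)) (g : multinom n) :
  measurable_fun D (fun x => \prod_(i < n) coord x i ^+ g i).
Proof.
apply: measurable_prod => i _; apply: measurable_funX.
exact: measurable_coord.
Qed.

Lemma measurable_meval (D : set (Rn R n)) (P : mpoly n R) :
  measurable_fun D (fun x => meval (coord x) P).
Proof.
under eq_fun do rewrite mevalE.
apply: measurable_sum => g; apply: measurable_funM; first exact: measurable_cst.
exact: measurable_monomial.
Qed.

End cubes.

(** * Integrals over sets that differ by a null set *)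

Section null_difference.
Context d (T : measurableType d) (R : realType).
Context (mu : {measure set T -> \bar R}).
Local Open Scope ereal_scope.

(** Without integrability of [g], the positive and negative parts are compared separately, as
    integrals of nonnegative functions. *)
Lemma integral_null_setD (A B : set T) (g : T -> \bar R) :
    measurable A -> measurable B -> A `<=` B -> mu (B `\` A) = 0 ->
    measurable_fun B g ->
  \int[mu]_(x in B) g x = \int[mu]_(x in A) g x.
Proof.
move=> mA mB AB BA0 mg; have mBA : measurable (B `\` A) by exact: measurableD.
rewrite [in RHS](_ : A = B `\` (B `\` A)); last by rewrite setDD setIidr.
have negl (h : T -> \bar R) : measurable_fun B h -> (forall x, 0 <= h x) ->
    \int[mu]_(x in B) h x = \int[mu]_(x in B `\` (B `\` A)) h x.
  by move=> mh h0; apply: ge0_negligible_integral.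
rewrite integralE [RHS]integralE; congr (_ - _); apply: negl => //.
  exact: measurable_funepos.
exact: measurable_funeneg.
Qed.

End null_difference.

(** * Mean oscillation and the comparison of the two norms *)

Section mean_osc.
Context (R : realType) (n : nat).
Local Notation mu := (@lebesgue R n).
Local Notation coord := (@Defs.coord R n).
Implicit Types (Q : set (Rn R n)) (f : Rn R n -> R).
Local Open Scope ereal_scope.

Lemma mean_osc_ge0 alpha q s Q f : 0 <= mean_osc alpha q s Q f.
Proof. by rewrite mule_ge0// poweR_ge0. Qed.

(** All moment integrals agree on [Q] and [Q'], so [is_projection] defines the same set of
    polynomials and [xget] picks the same element; neither existence nor uniqueness of the
    projection enters. *)
Lemma mean_osc_null_setD alpha q s Q Q' f :
    measurable Q -> measurable Q' -> Q `<=` Q' -> mu (Q' `\` Q) = 0 ->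
    mu Q' = mu Q -> measurable_fun Q' f ->
  mean_osc alpha q s Q f = mean_osc alpha q s Q' f.
Proof.
move=> mQ mQ' QQ' D0 muE mf.
have mfP P : measurable_fun Q' (fun x => f x - meval (coord x) P)%R.
  by apply: measurable_funB; [exact: mf|exact: measurable_meval].
have projE : projection s Q f = projection s Q' f.
  rewrite /projection; congr xget; apply/seteqP.
  have intE P (g : multinom n) : \int[mu]_(x in Q')
      ((f x - meval (coord x) P) * \prod_(i < n) coord x i ^+ g i)%:E =
    \int[mu]_(x in Q)
      ((f x - meval (coord x) P) * \prod_(i < n) coord x i ^+ g i)%:E.
    apply: integral_null_setD; [exact: mQ|exact: mQ'|exact: QQ'|exact: D0|].
    apply/measurable_EFinP.
    by apply: measurable_funM; [exact: mfP|exact: measurable_monomial].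
  by split=> P [sP intP]; split=> // g gs; rewrite -(intP g gs) intE.
have mfPq P : measurable_fun Q'
    (fun x => (`|f x - meval (coord x) P| `^ q)%:E).
  apply/measurable_EFinP.
  apply: (measurableT_comp (measurable_powR q)).
  exact: (measurableT_comp (@normr_measurable _ _)).
rewrite /mean_osc projE muE; congr (_ * _); congr (_ `^ _).
congr (_ * _); apply/esym.
by apply: integral_null_setD; [exact: mQ|exact: mQ'|exact: QQ'|exact: D0|].
Qed.

(** The sum is a supremum over finite subfamilies, and for each of these disjointness turns the
    total measure into that of a union inside [Q0]. *)
Lemma esum_disjoint_cubes_le (Q0 : set (Rn R n)) C (a : set (Rn R n) -> \bar R)
    (S : \bar R) :
    measurable Q0 -> disjoint_cubes Q0 C ->
    0 <= S -> (forall Q, C Q -> a Q <= S) ->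
  \esum_(Q in C) mu Q * a Q <= mu Q0 * S.
Proof.
move=> mQ0 [cC tC] S0 aS; apply: ge_ereal_sup => _ [A [finA AC] <-].
have mA Q : A Q -> measurable Q by move=> /AC /cC[/cube_closureP[? _ []]].
apply: (@le_trans _ _ (\sum_(Q \in A) mu Q * S)).
  by apply: lee_fsum => // Q AQ; apply: lee_wpmul2l => //; exact/aS/AC.
rewrite -ge0_mule_fsuml//; apply: lee_wpmul2r => //.
rewrite -(@measure_fsbig _ _ _ mu _ A id)//; last exact: sub_trivIset tC.
have mU : measurable (\big[setU/set0]_(Q \in A) Q).
  by rewrite fsbig_setU//; exact: fin_bigcup_measurable.
apply: le_measure; rewrite ?inE//.
by rewrite fsbig_setU//; apply: bigcup_sub => Q /AC /cC[].
Qed.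

Section norms.
Context (alpha q : R) (s : nat) (Q0 : set (Rn R n)) (f : Rn R n -> R).
Context (cQ0 : closed_cube Q0) (mf : measurable_fun Q0 f).
Local Notation N := (campanato_norm alpha q s Q0 f).
Local Notation J p := (jnc_norm p q s alpha Q0 f).

Lemma mean_osc_le_campanato_norm Q : cube Q -> Q `<=` Q0 ->
  mean_osc alpha q s Q f <= N.
Proof.
move=> /cube_closureP[Q' [cQ' QQ'] [mQ mQ' muE D0 sub]] QQ0.
have Q'Q0 := sub _ cQ0 QQ0.
rewrite (@mean_osc_null_setD _ _ _ _ Q')//.
  by apply: ereal_sup_ubound; exists Q'.
by apply: measurable_funS mf => //; case: (closed_cube_measure cQ0).
Qed.

Lemma campanato_norm_ge0 : 0 <= N.
Proof.
(* [Q0] is itself a test cube, so the supremum is not the [-oo] of an empty family. *)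
apply: le_trans (@mean_osc_le_campanato_norm Q0 _ _) => //.
  exact: mean_osc_ge0.
exact: closed_cube_cube.
Qed.

Lemma jnc_norm_ge_mean_osc Q p : (0 < p)%R -> closed_cube Q -> Q `<=` Q0 ->
  mu Q `^ p^-1 * mean_osc alpha q s Q f <= J p.
Proof.
move=> p0 cQ QQ0; apply: ereal_sup_ubound; exists [set Q].
  split; first by move=> _ ->; split => //; exact: closed_cube_cube.
  by move=> i j -> ->.
rewrite esum_set1 ?mule_ge0 ?poweR_ge0// poweR_mul_powRV//.
exact: mean_osc_ge0.
Qed.

Lemma jnc_norm_le p : (0 < p)%R -> J p <= mu Q0 `^ p^-1 * N.
Proof.
move=> p0; have [mQ0 _] := closed_cube_measure cQ0.
apply: ge_ereal_sup => _ [C dC <-].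
rewrite -poweR_mul_powRV ?campanato_norm_ge0//.
have sum_ge0 : 0 <= \esum_(Q in C) mu Q * mean_osc alpha q s Q f `^ p.
  by apply: esum_ge0 => Q _; rewrite mule_ge0// poweR_ge0.
apply: gt0_ler_poweR; rewrite ?in_itv/= ?leey ?andbT ?invr_ge0 ?(ltW p0)//.
  by rewrite mule_ge0// poweR_ge0.
apply: esum_disjoint_cubes_le => // [|Q /dC.1[cQ QQ0]]; first exact: poweR_ge0.
apply: gt0_ler_poweR; rewrite ?in_itv/= ?leey ?andbT ?(ltW p0)//.
- exact: mean_osc_ge0.
- exact: campanato_norm_ge0.
- exact: mean_osc_le_campanato_norm.
Qed.

End norms.
End mean_osc.

(** * Convergence of the norms and equality of the spaces *)

Lemma cvg_jnc_norm (R : realType) (n : nat) (q alpha : R) (s : nat)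
    (Q0 : set (Rn R n)) (f : Rn R n -> R) :
    closed_cube Q0 -> measurable_fun Q0 f ->
  jnc_norm p q s alpha Q0 f @[p --> +oo%R] --> campanato_norm alpha q s Q0 f.
Proof.
move=> cQ0 mf; have [_ [m0 m0_gt0 muQ0]] := closed_cube_measure cQ0.
(* The index set consists of the closed cubes in [Q0], weighted by their measures, which are
   positive reals; hence [fine] loses nothing. *)
apply: (@cvg_powRV_ereal_sup _ _ _ (fun Q => fine (lebesgue Q)) _ _ _ m0_gt0).
- by move=> Q [/closed_cube_measure[_ [r r0 ->]]].
- exact: campanato_norm_ge0.
- move=> Q p [cQ QQ0] p1; have [_ [r r0 muQ]] := closed_cube_measure cQ.
  rewrite muQ -poweR_EFin -muQ; apply: jnc_norm_ge_mean_osc => //.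
  exact: lt_trans p1.
- move=> p p1; rewrite -poweR_EFin -muQ0; apply: jnc_norm_le => //.
  exact: lt_trans p1.
Qed.

Theorem corollary1p7 (R : realType) (n : nat) (n_gt0 : (0 < n)%N)
    (q alpha : R) (s : nat) (Q0 : set (Rn R n))
    (q_ge1 : 1 <= q) (alpha_ge0 : 0 <= alpha)
    (cubeQ0 : closed_cube Q0) (properQ0 : Q0 `<` [set: Rn R n]) :
  campanato alpha q s Q0 =
    [set f | (\bigcap_(p in [set p : R | 1 < p]) jnc p q s alpha Q0) f /\
       cvg (jnc_norm p q s alpha Q0 f @[p --> +oo%R]) /\
       (lim (jnc_norm p q s alpha Q0 f @[p --> +oo%R]) < +oo)%E]
  /\
  forall f : Rn R n -> R, campanato alpha q s Q0 f ->
    cvg (jnc_norm p q s alpha Q0 f @[p --> +oo%R]) /\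
    campanato_norm alpha q s Q0 f =
      lim (jnc_norm p q s alpha Q0 f @[p --> +oo%R]).
Proof.
(* Measurability alone is assumed, so that the limit can also be identified in the converse
   inclusion, where finiteness of the Campanato norm is still to be shown. *)
have lims f : measurable_fun Q0 f ->
    cvg (jnc_norm p q s alpha Q0 f @[p --> +oo%R]) /\
    campanato_norm alpha q s Q0 f =
      lim (jnc_norm p q s alpha Q0 f @[p --> +oo%R]).
  move=> mf; have J := @cvg_jnc_norm R n q alpha s Q0 f cubeQ0 mf.
  split; last by apply/esym/(cvg_lim _ J); exact: ereal_hausdorff.
  by apply/cvg_ex; exists (campanato_norm alpha q s Q0 f).
split; last by move=> f [[mf _] _]; exact: lims.
apply/seteqP; split=> f.
  move=> [Lf Nf]; have [mf _] := Lf; have [cJ NE] := lims f mf.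
  split; last by split; [exact: cJ|rewrite -NE; exact: Nf].
  move=> p /= p1; split => //.
  have p0 : 0 < p by exact: lt_trans p1.
  apply: le_lt_trans (jnc_norm_le _ _ _ cubeQ0 mf p0) _.
  have [_ [m0 m0_gt0 ->]] := closed_cube_measure cubeQ0.
  by rewrite poweR_EFin lte_mul_pinfty// lee_fin powR_ge0.
(* Any exponent above 1 would do: membership at [p = 2] only serves to extract [L1loc], and with it
   measurability. *)
move=> [Jf [_ limf]]; have /Jf[Lf _] : 1 < 2 :> R by rewrite ltr1n.
by split=> //; rewrite (lims f Lf.1).2.
Qed.
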